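(* Fix $\sigma>0$ and a nonnegative integer $C$ independent of $n$. If $G$ and $G'$ are two complete bipartite graphs, or two complete graphs, with $n$ and $n+C$ vertices respectively, then $D(G,G')=\mathcal{O}(1/n^2)$ as $n\to\infty$.
   Context: For a simple graph $G=(V,E)$ with $n$ vertices, the normalized Laplacian acts on functions $f:V\to\mathbb{R}$ by $\Delta_G f(x)=f(x)-\frac{1}{d_x}\sum_{y\sim x}f(y)$, where $d_x$ is the degree of $x$. Its spectrum consists of $n$ eigenvalues (with multiplicity) $0=\lambda_0\le\cdots\le\lambda_{n-1}\le 2$. For a fixed bandwidth $\sigma>0$ (the same for all graphs), let $\rho_G(x)=\frac1n\sum_{i=0}^{n-1}\frac{1}{\sqrt{2\pi\sigma^2}}e^{-\frac{(x-\lambda_i)^2}{2\sigma^2}}$ for $x\in\mathbb{R}$. The spectral distance of graphs $G,G'$ is $D(G,G')=\int_{\mathbb{R}}|\rho_G(x)-\rho_{G'}(x)|\,dx$. A complete bipartite graph has both parts nonempty. *)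

(* Defs.v *)
From HB Require Import structures.
From mathcomp Require Import all_boot all_order all_algebra.
From mathcomp Require Import all_classical all_reals all_analysis.
From mathcomp.real_closed Require Import polyrcf.

Set Implicit Arguments.
Unset Strict Implicit.
Unset Printing Implicit Defensive.

Import Order.TTheory GRing.Theory Num.Theory.
Import numFieldNormedType.Exports.

Local Open Scope ring_scope.

Record sgraph := SGraph {
  vertex :> finType;
  adj : rel vertex;
  adj_sym : symmetric adj;
  adj_irr : irreflexive adj
}.

Definition degree (G : sgraph) (x : G) : nat := #|[set y | adj x y]|.

Definition is_complete (G : sgraph) : Prop :=
  forall x y : G, adj x y = (x != y).

(* The parts are A and its complement. *)
Definition is_complete_bipartite (G : sgraph) : Prop :=
  exists A : {set G}, [/\ A != finset.set0, ~: A != finset.set0 &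
    forall x y : G, adj x y = ((x \in A) != (y \in A))].

(* At an isolated vertex the convention 0^-1 = 0 makes this f x. *)
Definition laplacian (R : realType) (G : sgraph) (f : G -> R) (x : G) : R :=
  f x - (degree x)%:R^-1 * \sum_(y | adj x y) f y.

(* The matrix of the operator in the basis of indicator functions of vertices;
   its j-th column is the image of the indicator of the j-th vertex. *)
Definition laplacian_mx (R : realType) (G : sgraph) : 'M[R]_#|G| :=
  \matrix_(i, j) laplacian (fun y => (y == enum_val j)%:R) (enum_val i).

(* The nondecreasing list of eigenvalues: rootsR lists the distinct real roots
   in increasing order, and mup a p is the multiplicity of a as a root of p.
   All eigenvalues are real, since the Laplacian is self-adjoint for the
   degree-weighted inner product; hence the list has length #|G|, and algebraic
   and geometric multiplicities agree. *)
Definition spectrum (R : realType) (G : sgraph) : seq R :=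
  let p := char_poly (laplacian_mx R G) in
  flatten [seq nseq (mup a p) a | a <- rootsR p].

(* For sigma != 0, normal_pdf l sigma is the density of the normal distribution
   of mean l and standard deviation sigma. *)
Definition spectral_density (R : realType) (sigma : R) (G : sgraph) (x : R) : R :=
  (#|G|%:R)^-1 * \sum_(l <- spectrum R G) normal_pdf l sigma x.

(* Extended-real valued, so that an upper bound on it includes finiteness. *)
Definition spectral_distance (R : realType) (sigma : R) (G G' : sgraph) : \bar R :=
  (\int[lebesgue_measure]_x
    `|spectral_density sigma G x - spectral_density sigma G' x|%:E)%E.

(* Main.v *)
Require Import Defs.
From HB Require Import structures.
From mathcomp Require Import all_boot all_order all_algebra.
From mathcomp Require Import all_classical all_reals all_analysis.
From mathcomp.real_closed Require Import polyrcf.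
From mathcomp Require Import measurable_realfun ring lra.
Import Order.TTheory GRing.Theory Num.Theory.
Import numFieldNormedType.Exports.
Local Open Scope classical_set_scope.
Local Open Scope ring_scope.

(** The spectra are explicit: a complete bipartite graph on n vertices has
    eigenvalues 0, 2 and n - 2 times 1, and a complete graph has 0 and n - 1
    times n / (n - 1). In both cases the Laplacian is a scalar matrix minus a
    product U V of rank at most 2, so the characteristic polynomial reduces to
    a determinant of size 1 or 2 by Sylvester's identity
    [det_scalar_addM].

    Write phi_m for the normal density of mean m. In the bipartite case the
    spectral density is phi_1 + (phi_0 + phi_2 - 2 phi_1) / n, so two such
    densities differ by the factor 1 / n - 1 / (n + C), which is at most
    C / n^2, times a fixed function of L1 norm at most 4.

    In the complete case let a and b be the multiple eigenvalues of the graphs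
    with n and n + C vertices. The difference of the densities is
      (1 / n - 1 / (n + C)) (phi_0 - phi_b) + (1 - 1 / n) (phi_a - phi_b).
    The first term is again O(1 / n^2). For the second,
    a - b = 1 / (n - 1) - 1 / (n + C - 1) = O(1 / n^2), and m |-> phi_m is
    Lipschitz in L1. The latter is proved pointwise: |phi_a - phi_b| is bounded
    by a constant times |a - b| times the sum of the densities of means a and b
    and doubled standard deviation [normal_pdf_lipschitz].

    Thus in both cases the difference is dominated by C / n^2 times a constant
    times a sum of four normal densities, each of integral 1
    [spectral_distance_le]. *)

(** * The spectrum from the characteristic polynomial *)

(** Both lists contain each b as often as its multiplicity as a root. *)
Lemma perm_spectrum (R : realType) (G : sgraph) (s : seq R) :
  char_poly (laplacian_mx R G) = \prod_(a <- s) ('X - a%:P) ->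
  perm_eq (spectrum R G) s.
Proof.
rewrite /spectrum => ->; set p := \prod_(_ <- _) _.
have p0 : p != 0 by rewrite monic_neq0 // monic_prod_XsubC.
apply/allP => b _ /=; apply/eqP.
have rootsE : (b \in rootsR p) = root p b.
  by rewrite -(roots_on_rootsR p0) in_itv.
have uniq_roots : uniq (rootsR p).
  exact: (sorted_uniq lt_trans (@ltxx _ _) (sorted_roots _ _ _)).
rewrite count_flatten -map_comp sumnE big_map.
under eq_bigr => a _ do rewrite /= count_nseq /=.
rewrite -mu_prod_XsubC -/p.
have [rb|nrb] := boolP (root p b).
  rewrite (bigD1_seq b) ?rootsE //= eqxx mul1n big1 ?addn0 // => a /negPf.
  by move->.
rewrite mupNroot // big1_seq // => a /andP[_ ar].
by case: eqP => [ab|]; rewrite ?mul0n //; rewrite ab rootsE (negPf nrb) in ar.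
Qed.

(** Sylvester's identity. Both sides compute, by block elimination in two
    different ways, the determinant of the block matrix with rows (t, U) and
    (- V, 1), multiplied by t ^+ k. No inverse of t is used, so t may be the
    polynomial 'X - a. *)
Lemma det_scalar_addM (R : comNzRingType) (n k : nat) (t : R)
    (U : 'M[R]_(n, k)) (V : 'M[R]_(k, n)) :
  \det (t%:M + U *m V) * t ^+ k = t ^+ n * \det (t%:M + V *m U).
Proof.
pose M := block_mx t%:M U (- V) 1%:M.
have detM : \det M = \det (t%:M + U *m V).
  have : M *m block_mx 1%:M 0 V 1%:M = block_mx (t%:M + U *m V) U 0 1%:M.
    by rewrite mulmx_block !mulmx1 !mul1mx !mulmx0 add0r add0r addNr.
  by move/(congr1 determinant); rewrite det_mulmx det_lblock det_ublock !det1 !mulr1.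
have : M *m block_mx 1%:M (- U) 0 t%:M = block_mx t%:M 0 (- V) (t%:M + V *m U).
  rewrite mulmx_block !mulmx1 !mulmx0 !addr0 mul1mx mul_scalar_mx mul_mx_scalar.
  by rewrite scalerN addNr mulNmx mulmxN opprK addrC.
move/(congr1 determinant).
by rewrite det_mulmx detM det_ublock det_lblock det1 mul1r !det_scalar.
Qed.

Lemma char_poly_scalar_subM (R : comNzRingType) (n k : nat) (a : R)
    (U : 'M[R]_(n, k)) (V : 'M[R]_(k, n)) :
  char_poly (a%:M - U *m V) * ('X - a%:P) ^+ k =
  ('X - a%:P) ^+ n * \det (('X - a%:P)%:M + map_mx polyC (V *m U)).
Proof.
rewrite [in RHS]map_mxM -det_scalar_addM /char_poly /char_poly_mx; congr (\det _ * _).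
by rewrite map_mxB map_scalar_mx map_mxM opprB addrA addrAC raddfB /= .
Qed.

Lemma det_mx22 (R : comNzRingType) (A : 'M[R]_2) :
  \det A = A 0 0 * A 1 1 - A 0 1 * A 1 0.
Proof.
rewrite (expand_det_row _ 0) !big_ord_recl big_ord0 addr0 /cofactor !det_mx11.
rewrite !mxE /= expr0 expr1 mul1r mulN1r mulrN.
by congr (_ * A _ _ - A _ _ * A _ _); apply/val_inj.
Qed.

(** * The spectra of complete and complete bipartite graphs *)

Lemma laplacian_mxE (R : realType) (G : sgraph) (i j : 'I_#|G|) :
  laplacian_mx R G i j = (i == j)%:R
    - (degree (enum_val i))%:R^-1 * (adj (enum_val i) (enum_val j))%:R.
Proof.
rewrite mxE /laplacian (inj_eq enum_val_inj); congr (_ - _ * _).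
have [axy|naxy] := boolP (adj _ _).
  rewrite (bigD1 (enum_val j)) //= eqxx big1 ?addr0 // => y /andP[_ /negPf].
  by move=> ->.
rewrite big1 // => y ay; case: eqP => // yj.
by rewrite -yj ay in naxy.
Qed.

(** With N = n + 2 vertices and a = N / (N - 1), the Laplacian is a minus U V
    for U V the all-ones matrix divided by N - 1; here V U is the number a
    itself, whence the eigenvalue a - a = 0. *)
Lemma char_poly_complete (R : realType) (G : sgraph) (n : nat) :
  is_complete G -> #|G| = n.+2 ->
  char_poly (laplacian_mx R G) =
  \prod_(a <- 0 :: nseq n.+1 (n.+2%:R / n.+1%:R)) ('X - a%:P).
Proof.
move=> Gc Gn; set a : R := n.+2%:R / n.+1%:R.
have degE (x : G) : degree x = n.+1.
  rewrite /degree -[RHS]/(n.+2.-1) -Gn -(cardsC1 x); congr #|pred_of_set _|.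
  by apply/setP => y; rewrite !inE Gc eq_sym.
pose U : 'M[R]_(#|G|, 1) := const_mx n.+1%:R^-1.
pose V : 'M[R]_(1, #|G|) := const_mx 1.
have LE : laplacian_mx R G = a%:M - U *m V.
  apply/matrixP => i j; rewrite laplacian_mxE degE Gc (inj_eq enum_val_inj).
  rewrite !mxE big_ord1 !mxE /a -[n.+2]addn1 natrD.
  by case: (i == j) => /=; field; rewrite -?[1 + _]addrC ?natr1 ?nat1r pnatr_eq0.
have VU : V *m U = a%:M.
  apply/matrixP => i j; rewrite !mxE !ord1 eqxx mulr1n.
  under eq_bigr => k _ do rewrite !mxE mul1r.
  by rewrite sumr_const card_ord Gn /a mulr_natl.
apply: (@mulIf _ ('X - a%:P)); first by rewrite polyXsubC_eq0.
have := char_poly_scalar_subM _ _ _ a U V.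
rewrite -LE VU det_mx11 !mxE eqxx !mulr1n subrK expr1 => ->.
by rewrite big_cons big_nseq iter_mulr_1 Gn exprSr subr0 mulrC mulrA.
Qed.

(** The normalized adjacency matrix is U V, where the two columns of U and the
    two rows of V are supported on the parts. With p and q the sizes of the
    parts, V U has zero diagonal and off-diagonal entries q / p and p / q, so
    the reduced determinant is ('X - 1)^2 - 1 = 'X ('X - 2), independently of
    p and q. *)
Lemma char_poly_complete_bipartite (R : realType) (G : sgraph) (n : nat) :
  is_complete_bipartite G -> #|G| = n.+2 ->
  char_poly (laplacian_mx R G) =
  \prod_(a <- [:: 0, 2 & nseq n 1]) ('X - a%:P).
Proof.
move=> [A [A0 A'0 GA]] Gn.
have degE (x : G) : degree x = if x \in A then #|~: A| else #|A|.
  rewrite /degree; case: ifP => xA; congr #|pred_of_set _|; apply/setP => y;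
    by rewrite !inE GA xA; case: (y \in A).
pose U : 'M[R]_(#|G|, 2) := \matrix_(i, k)
  if (enum_val i \in A) == (k == 0) then (degree (enum_val i))%:R^-1 else 0.
pose V : 'M[R]_(2, #|G|) := \matrix_(k, j) ((enum_val j \in A) != (k == 0))%:R.
have LE : laplacian_mx R G = 1%:M - U *m V.
  apply/matrixP => i j; rewrite laplacian_mxE GA !mxE !big_ord_recl big_ord0 !mxE.
  case: (_ \in A); case: (_ \in A);
  by rewrite /= ?(mulr0, mulr1, mul0r, addr0, add0r).
pose p : R := #|A|%:R; pose q : R := #|~: A|%:R.
have p0 : p != 0 by rewrite pnatr_eq0 cards_eq0.
have q0 : q != 0 by rewrite pnatr_eq0 cards_eq0.
pose w (b c : bool) (x : G) : R := ((x \in A) != b)%:R *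
  (if (x \in A) == c then (if x \in A then #|~: A| else #|A|)%:R^-1 else 0).
have VUE k l : (V *m U) k l = \sum_(x : G) w (k == 0) (l == 0) x.
  rewrite mxE (big_enum_val (w _ _)); apply: eq_bigr => i _.
  by rewrite !mxE degE /w; case: (_ == _).
have wbb b : \sum_(x : G) w b b x = 0.
  by apply: big1 => x _; rewrite /w; case: (_ == b); rewrite ?mul0r ?mulr0.
have wtf : \sum_(x : G) w true false x = q / p.
  transitivity (\sum_(x in ~: A) p^-1); last by rewrite sumr_const mulr_natl.
  rewrite [RHS]big_mkcond; apply: eq_bigr => x _.
  by rewrite /w inE; case: (x \in A); rewrite ?mul0r ?mul1r.
have wft : \sum_(x : G) w false true x = p / q.
  transitivity (\sum_(x in A) q^-1); last by rewrite sumr_const mulr_natl.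
  rewrite [RHS]big_mkcond; apply: eq_bigr => x _.
  by rewrite /w; case: (x \in A); rewrite ?mul0r ?mul1r.
have ME k l : (('X - 1%:P)%:M + map_mx polyC (V *m U)) k l =
    ('X - 1%:P) *+ (k == l) + (\sum_(x : G) w (k == 0) (l == 0) x)%:P.
  by rewrite mxE [X in X + _]mxE [X in _ + X]mxE VUE.
apply: (@mulIf _ (('X - 1%:P) ^+ 2)); first by rewrite expf_neq0 // polyXsubC_eq0.
have := char_poly_scalar_subM _ _ _ 1 U V.
rewrite -LE det_mx22 !ME /= !wbb wtf wft !mulr1n !mulr0n !add0r !addr0 => ->.
have pq1 : (q / p)%:P * (p / q)%:P = 1 :> {poly R}.
  by rewrite -polyCM mulrA divfK // divff.
rewrite pq1 !big_cons big_nseq iter_mulr_1 Gn -(addn2 n) exprD subr0.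
rewrite -[2]natr1 polyCD !polyC1.
ring.
Qed.

Lemma spectral_density_complete (R : realType) (sigma : R) (G : sgraph) (n : nat)
    (x : R) :
  is_complete G -> #|G| = n.+2 ->
  spectral_density sigma G x = n.+2%:R^-1 *
    (normal_pdf 0 sigma x +
     n.+1%:R * normal_pdf (n.+2%:R / n.+1%:R) sigma x).
Proof.
move=> Gc Gn; rewrite /spectral_density Gn.
rewrite (perm_big _ (perm_spectrum _ _ _ (char_poly_complete _ _ _ Gc Gn))).
by rewrite big_cons big_nseq iter_addr_0 [n.+1%:R * _]mulr_natl.
Qed.

Lemma spectral_density_complete_bipartite (R : realType) (sigma : R) (G : sgraph)
    (n : nat) (x : R) :
  is_complete_bipartite G -> #|G| = n.+2 ->
  spectral_density sigma G x = n.+2%:R^-1 *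
    (normal_pdf 0 sigma x + normal_pdf 2 sigma x + n%:R * normal_pdf 1 sigma x).
Proof.
move=> Gb Gn; rewrite /spectral_density Gn.
rewrite (perm_big _ (perm_spectrum _ _ _
  (char_poly_complete_bipartite _ _ _ Gb Gn))).
by rewrite !big_cons big_nseq iter_addr_0 mulr_natl [in RHS]/= -addrA.
Qed.

(** * Bounding the spectral distance by normal densities *)

Lemma measurable_spectral_density (R : realType) (sigma : R) (G : sgraph) :
  measurable_fun setT (spectral_density sigma G).
Proof.
apply: measurable_funM => //; apply: measurable_sum => l.
exact: measurable_normal_pdf.
Qed.

(** A pair d in s encodes the normal density of mean d.1 and standard deviation
    d.2, which has integral 1. *)
Lemma spectral_distance_le (R : realType) (sigma : R) (G G' : sgraph) (c : R)
    (s : seq (R * R)) :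
  0 <= c ->
  (forall x, `|spectral_density sigma G x - spectral_density sigma G' x| <=
    c * \sum_(d <- s) normal_pdf d.1 d.2 x) ->
  (spectral_distance sigma G G' <= (c * (size s)%:R)%:E)%E.
Proof.
move=> c0 le_c.
have mpdf (d : R * R) :
    measurable_fun [set: R] (fun x => (normal_pdf d.1 d.2 x)%:E).
  by apply/measurable_EFinP; exact: measurable_normal_pdf.
have -> : (c * (size s)%:R)%:E = (\int[lebesgue_measure]_x
    (c%:E * \sum_(d <- s) (normal_pdf d.1 d.2 x)%:E))%E.
  rewrite ge0_integralZl //; last 2 first.
  - by apply: emeasurable_sum => d; exact: mpdf.
  - by move=> x _; apply: sume_ge0 => d _; rewrite lee_fin normal_pdf_ge0.
  rewrite ge0_integral_sum //; last first.
    by move=> d x _; rewrite lee_fin normal_pdf_ge0.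
  rewrite (eq_bigr (fun=> 1%E)) => [|d _]; last exact: integral_normal_pdf.
  by rewrite EFinM sumEFin big_const_seq count_predT iter_addr_0.
apply: ge0_le_integral => //=.
- apply/measurable_EFinP; apply: measurableT_comp => //.
  by apply: measurable_funB; exact: measurable_spectral_density.
- by apply: emeasurable_funM => //; apply: emeasurable_sum => d; exact: mpdf.
- by move=> x _; rewrite sumEFin -EFinM lee_fin.
Qed.

(** For p <= q, multiply 1 - e^(p - q) <= q - p by e^q; the sum on the right
    makes the bound symmetric in p and q. *)
Lemma norm_expR_sub_le (R : realType) (p q : R) :
  `|expR p - expR q| <= `|p - q| * (expR p + expR q).
Proof.
wlog pq : p q / p <= q.
  move=> H; have [/H//|/ltW/H] := leP p q.
  by rewrite (distrC (expR p)) (distrC p) (addrC (expR p)).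
rewrite (distrC (expR p)) (distrC p) !ger0_norm ?subr_ge0 ?ler_expR //.
have : expR p = expR q * expR (p - q) by rewrite -expRD addrC subrK.
have := expR_ge1Dx (p - q); have := expR_gt0 q; have := expR_gt0 p.
nra.
Qed.

(** Doubling the standard deviation halves the peak; this form allows two
    densities of different widths to be compared through their exponentials. *)
Lemma normal_pdf_peak_double (R : realType) (sigma m x : R) : 0 < sigma ->
  normal_pdf m sigma x =
  2 * normal_peak (2 * sigma) * expR (- (x - m) ^+ 2 / (sigma ^+ 2 *+ 2)).
Proof.
move=> s0; rewrite normal_pdfE ?gt_eqF // /normal_peak /normal_fun.
have -> : (2 * sigma) ^+ 2 * pi *+ 2 = 2 ^+ 2 * (sigma ^+ 2 * pi *+ 2).
  by rewrite exprMn mulrnAr mulrA.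
by rewrite sqrtrM ?sqr_ge0 // sqrtr_sqr ger0_norm // invfM mulVKf.
Qed.

(** The linear factor, which comes from the difference of the exponents of two
    translates, is absorbed by widening the Gaussian. With v = u^2 / sigma^2 the
    exponents on the two sides differ by 3 v / 8, and
      2 |u| + 1 <= u^2 + 2 <= (2 + 3 sigma^2) (1 + 3 v / 8)
    while 1 + 3 v / 8 <= e^(3 v / 8). *)
Lemma affine_normal_le (R : realType) (sigma u : R) : 0 < sigma ->
  (2 * `|u| + 1) * expR (- u ^+ 2 / (sigma ^+ 2 *+ 2)) <=
  (2 + 3 * sigma ^+ 2) * expR (- u ^+ 2 / ((2 * sigma) ^+ 2 *+ 2)).
Proof.
move=> s0; set v := u ^+ 2 / sigma ^+ 2.
have v0 : 0 <= v by rewrite divr_ge0 ?sqr_ge0.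
have uv : u ^+ 2 = v * sigma ^+ 2 by rewrite divfK // expf_neq0 // gt_eqF.
have -> : - u ^+ 2 / (sigma ^+ 2 *+ 2) = - u ^+ 2 / ((2 * sigma) ^+ 2 *+ 2)
    - 3 / 8 * v.
  by rewrite /v; field; rewrite gt_eqF.
rewrite expRD mulrCA mulrC ler_pM2r ?expR_gt0 //.
rewrite expRN ler_pdivrMr ?expR_gt0 //.
have := expR_ge1Dx (3 / 8 * v); set e := expR _ => e1.
have u2 : `|u| ^+ 2 = u ^+ 2 by rewrite real_normK ?num_real.
have h : (2 + 3 * sigma ^+ 2) * (1 + 3 / 8 * v) <= (2 + 3 * sigma ^+ 2) * e.
  by rewrite ler_wpM2l // addr_ge0 // mulr_ge0 // sqr_ge0.
apply: le_trans h.
have := sqr_ge0 (`|u| - 1); have := sqr_ge0 sigma.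
move: u2 uv; rewrite !expr2.
set U := `|u|; nra.
Qed.

(** The exponents (x - a)^2 / (2 sigma^2) and (x - b)^2 / (2 sigma^2) differ by
    |a - b| |2 x - a - b| / (2 sigma^2), and |2 x - a - b| is at most
    2 |x - a| + 1 and 2 |x - b| + 1 because |a - b| <= 1. *)
Lemma normal_pdf_lipschitz (R : realType) (sigma a b x : R) :
  0 < sigma -> `|a - b| <= 1 ->
  `|normal_pdf a sigma x - normal_pdf b sigma x| <=
  (2 / sigma ^+ 2 + 3) * `|a - b| *
    (normal_pdf a (2 * sigma) x + normal_pdf b (2 * sigma) x).
Proof.
move=> s0 ab1; have s20 : 2 * sigma != 0 by rewrite mulf_neq0 // gt_eqF.
rewrite !(normal_pdf_peak_double _ sigma) // !(normal_pdfE _ s20) /normal_fun.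
rewrite -mulrBr normrM ger0_norm ?mulr_ge0 ?normal_peak_ge0 //.
rewrite -mulrDr [leRHS]mulrCA -mulrA [leLHS]mulrCA.
apply: ler_wpM2l; first exact: normal_peak_ge0.
have ha := affine_normal_le _ _ (x - a) s0.
have hb := affine_normal_le _ _ (x - b) s0.
set ea := expR (- (x - a) ^+ 2 / (sigma ^+ 2 *+ 2)) in ha *.
set eb := expR (- (x - b) ^+ 2 / (sigma ^+ 2 *+ 2)) in hb *.
apply: (@le_trans _ _ (2 * (`|a - b| * `|2 * x - a - b| / (sigma ^+ 2 *+ 2)
    * (ea + eb)))).
  rewrite ler_pM2l // (le_trans (norm_expR_sub_le _ _ _)) // -/ea -/eb.
  rewrite le_eqVlt; apply/orP; left; apply/eqP; congr (_ * _).
  rewrite -mulrBl normrM normfV -normrM [in X in _ / X]ger0_norm; last first.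
    by rewrite mulrn_wge0 // sqr_ge0.
  by congr (`| _ | / _); ring.
have k0 : 0 <= `|a - b| / sigma ^+ 2 by rewrite divr_ge0 ?sqr_ge0.
have -> : 2 * (`|a - b| * `|2 * x - a - b| / (sigma ^+ 2 *+ 2) * (ea + eb)) =
  `|a - b| / sigma ^+ 2 * (`|2 * x - a - b| * (ea + eb)).
  by field; rewrite gt_eqF.
have -> : (2 / sigma ^+ 2 + 3) * `|a - b| =
  `|a - b| / sigma ^+ 2 * (2 + 3 * sigma ^+ 2).
  by field; rewrite gt_eqF.
rewrite -[leRHS]mulrA ler_wpM2l // mulrDr mulrDr lerD //.
  apply: le_trans ha; rewrite ler_wpM2r ?expR_ge0 //.
  have -> : 2 * x - a - b = 2 * (x - a) + (a - b) by ring.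
  by rewrite (le_trans (ler_normD _ _)) // normrM (ger0_norm (ler0n _ 2)) lerD2l.
apply: le_trans hb; rewrite ler_wpM2r ?expR_ge0 //.
have -> : 2 * x - a - b = 2 * (x - b) - (a - b) by ring.
by rewrite (le_trans (ler_normB _ _)) // normrM (ger0_norm (ler0n _ 2)) lerD2l.
Qed.

(** * The distance of order 1 / n^2 *)

Lemma invn_subD (R : realType) (m C : nat) :
  m.+1%:R^-1 - (m + C).+1%:R^-1 = C%:R / (m.+1%:R * (m + C).+1%:R) :> R.
Proof. by rewrite -addSn natrD; field; rewrite ?nat1r ?natr1 -?natrD !pnatr_eq0. Qed.

Lemma invn_subD_le (R : realType) (m C : nat) :
  m.+1%:R^-1 - (m + C).+1%:R^-1 <= C%:R / m.+1%:R ^+ 2 :> R.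
Proof.
rewrite invn_subD ler_wpM2l // lef_pV2 ?posrE ?mulr_gt0 ?exprn_gt0 ?ltr0n //.
by rewrite expr2 ler_pM2l ?ltr0n // ler_nat ltnS leq_addr.
Qed.

Lemma spectral_distance_complete_bipartite_le (R : realType) (sigma : R)
    (m C : nat) (G G' : sgraph) :
  is_complete_bipartite G -> is_complete_bipartite G' ->
  #|G| = m.+2 -> #|G'| = (m + C).+2 ->
  (spectral_distance sigma G G' <= (4 * C%:R / m.+2%:R ^+ 2)%:E)%E.
Proof.
move=> Gb Gb' Gn Gn'.
have -> : 4 * C%:R / m.+2%:R ^+ 2 = C%:R / m.+2%:R ^+ 2 *
    (size [:: (0 : R, sigma); (2, sigma); (1, sigma); (1, sigma)])%:R :> R.
  by rewrite -mulrA mulrC.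
apply: spectral_distance_le => [|x]; first by rewrite divr_ge0 ?exprn_ge0.
rewrite (spectral_density_complete_bipartite _ _ _ _ _ Gb Gn).
rewrite (spectral_density_complete_bipartite _ _ _ _ _ Gb' Gn').
rewrite !big_cons big_nil /=.
have := normal_pdf_ge0 0 sigma x; have := normal_pdf_ge0 1 sigma x.
have := normal_pdf_ge0 2 sigma x.
set f0 := normal_pdf 0 _ _; set f1 := normal_pdf 1 _ _.
set f2 := normal_pdf 2 _ _ => f2_ge0 f1_ge0 f0_ge0.
have -> : m.+2%:R^-1 * (f0 + f2 + m%:R * f1) -
    (m + C).+2%:R^-1 * (f0 + f2 + (m + C)%:R * f1) =
    (m.+2%:R^-1 - (m + C).+2%:R^-1) * (f0 + f2 - (f1 + f1)).
  rewrite -[m.+2]addn2 -[(m + C).+2]addn2 !natrD.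
  by field; rewrite ?nat1r ?natr1 -?natrD !pnatr_eq0 !addn2.
have d_ge0 : 0 <= m.+2%:R^-1 - (m + C).+2%:R^-1 :> R.
  by rewrite invn_subD divr_ge0 ?mulr_ge0.
rewrite normrM ger0_norm // ler_pM ?invn_subD_le //.
rewrite ler_norml; apply/andP; split; lra.
Qed.

(** The factor 4 in front of the Lipschitz constant comes from
    1 / (n - 1)^2 <= 4 / n^2 for n = m + 2. *)
Lemma spectral_distance_complete_le (R : realType) (sigma : R) (m C : nat)
    (G G' : sgraph) :
  0 < sigma -> is_complete G -> is_complete G' ->
  #|G| = m.+2 -> #|G'| = (m + C).+2 ->
  (spectral_distance sigma G G' <=
   (4 * (1 + 4 * (2 / sigma ^+ 2 + 3)) * C%:R / m.+2%:R ^+ 2)%:E)%E.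
Proof.
move=> sigma0 Gc Gc' Gn Gn'; set L := 2 / sigma ^+ 2 + 3.
have L_ge0 : 0 <= L by rewrite addr_ge0 // divr_ge0 // sqr_ge0.
pose a : R := m.+2%:R / m.+1%:R; pose b : R := (m + C).+2%:R / (m + C).+1%:R.
have abE : a - b = m.+1%:R^-1 - (m + C).+1%:R^-1.
  rewrite /a /b -[m.+2]addn1 -[(m + C).+2]addn1 !natrD.
  by field; rewrite -?natrD ?nat1r !pnatr_eq0.
have ab_ge0 : 0 <= a - b by rewrite abE invn_subD divr_ge0 ?mulr_ge0.
have ab_le1 : `|a - b| <= 1.
  rewrite ger0_norm // abE lerBlDr (@le_trans _ _ 1) ?lerDl ?invr_ge0 //.
  by rewrite invf_le1 ?ltr0n // ler1n.
pose c : R := C%:R / m.+2%:R ^+ 2.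
have c_ge0 : 0 <= c by rewrite divr_ge0 ?exprn_ge0.
have ab_le : a - b <= 4 * c.
  rewrite abE (le_trans (invn_subD_le _ _ _)) // /c mulrCA ler_wpM2l //.
  rewrite ler_pdivlMr ?exprn_gt0 ?ltr0n // mulrC ler_pdivrMr ?exprn_gt0 ?ltr0n //.
  rewrite -!natrX -natrM ler_nat (_ : 4 = 2 ^ 2)%N // -expnMn leq_sqr.
  by rewrite mul2n doubleS !ltnS -addnn leq_addr.
have -> : 4 * (1 + 4 * L) * C%:R / m.+2%:R ^+ 2 = (1 + 4 * L) * c *
    (size [:: (0, sigma); (b, sigma); (a, 2 * sigma); (b, 2 * sigma)])%:R :> R.
  by rewrite /c /=; ring.
apply: spectral_distance_le => [|x].
  by rewrite mulr_ge0 // addr_ge0 // mulr_ge0.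
rewrite (spectral_density_complete _ _ _ _ _ Gc Gn).
rewrite (spectral_density_complete _ _ _ _ _ Gc' Gn').
rewrite !big_cons big_nil /= -/a -/b.
have := normal_pdf_lipschitz _ sigma a b x sigma0 ab_le1.
have := normal_pdf_ge0 0 sigma x; have := normal_pdf_ge0 b sigma x.
have := normal_pdf_ge0 a (2 * sigma) x; have := normal_pdf_ge0 b (2 * sigma) x.
set f0 := normal_pdf 0 _ _; set fa := normal_pdf a sigma _.
set fb := normal_pdf b sigma _; set ga := normal_pdf a (2 * sigma) _.
set gb := normal_pdf b (2 * sigma) _ => gb_ge0 ga_ge0 fb_ge0 f0_ge0 fab.
have -> : m.+2%:R^-1 * (f0 + m.+1%:R * fa) -
    (m + C).+2%:R^-1 * (f0 + (m + C).+1%:R * fb) =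
    (m.+2%:R^-1 - (m + C).+2%:R^-1) * (f0 - fb) + m.+1%:R / m.+2%:R * (fa - fb).
  rewrite -[m.+2]addn1 -[(m + C).+2]addn1 !natrD.
  by field; rewrite -?natrD ?nat1r ?natr1 !pnatr_eq0.
have d_ge0 : 0 <= m.+2%:R^-1 - (m + C).+2%:R^-1 :> R.
  by rewrite invn_subD divr_ge0 ?mulr_ge0.
have h1 : `|(m.+2%:R^-1 - (m + C).+2%:R^-1) * (f0 - fb)| <= c * (f0 + fb).
  rewrite normrM ger0_norm // ler_pM ?invn_subD_le //.
  by rewrite ler_norml; apply/andP; split; lra.
have h2 : `|m.+1%:R / m.+2%:R * (fa - fb)| <= 4 * L * c * (ga + gb).
  rewrite normrM ger0_norm ?divr_ge0 // -[leRHS]mul1r ler_pM ?divr_ge0 //.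
    by rewrite ler_pdivrMr ?ltr0n // mul1r ler_nat.
  apply: le_trans fab _; rewrite ler_wpM2r ?addr_ge0 // [4 * L]mulrC -mulrA.
  by rewrite ler_wpM2l // ger0_norm.
apply: le_trans (ler_normD _ _) _.
have := mulr_ge0 (mulr_ge0 L_ge0 c_ge0) (addr_ge0 f0_ge0 fb_ge0).
have := mulr_ge0 c_ge0 (addr_ge0 ga_ge0 gb_ge0).
lra.
Qed.

Theorem mainTheorem5 (R : realType) (sigma : R) (hsigma : 0 < sigma) (C : nat) :
  exists K : R, \forall n \near \oo, forall G G' : sgraph,
    #|G| = n -> #|G'| = (n + C)%N ->
    (is_complete_bipartite G /\ is_complete_bipartite G') \/
    (is_complete G /\ is_complete G') ->
    (spectral_distance sigma G G' <= (K / n%:R ^+ 2)%:E)%E.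
Proof.
set L := 1 + 4 * (2 / sigma ^+ 2 + 3).
have L_ge1 : 1 <= L.
  by rewrite lerDl mulr_ge0 // addr_ge0 // divr_ge0 // sqr_ge0.
exists (4 * L * C%:R); near=> n => G G' Gn Gn' GG'.
have [m nE] : exists m, n = m.+2.
  have : (2 <= n)%N by near: n; exact: nbhs_infty_ge.
  by case: (n) => [|[|m]] // _; exists m.
move: Gn Gn'; rewrite nE => Gn Gn'; case: GG' => -[h h'].
- apply: le_trans
    (spectral_distance_complete_bipartite_le _ _ _ _ _ _ h h' Gn Gn') _.
  by rewrite lee_fin ler_wpM2r ?invr_ge0 ?exprn_ge0 // ler_wpM2r // ler_peMr.
- exact: spectral_distance_complete_le.
Unshelve. all: by end_near.
Qed.
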